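(* Suppose that $\mu:=\min\{\mu_1,\mu_2\}>0$ and let $(x^{*},y^{*})$ be a saddle-point of $f$. Let $\sigma,\alpha,\beta,\gamma,\delta\in\mathbf{R}_{++}$, and suppose that for every $k\in\mathbf{N}$, $\tau_k=\sigma_k=\sigma$, $\lambda_k=\theta_k=\theta:=\frac{1}{1+\mu\sigma}\in(0,1)$, and $t_k=\frac{t_0}{\theta^k}$ with $t_0\in\mathbf{R}_{++}$. Suppose that $$\eta_x:=1-\sigma\left(\frac{1}{1+\mu\sigma}(L_{xx}\alpha+L_{xy}\beta)+\frac{L_{xx}}{\alpha}+\frac{L_{yx}}{\gamma}\right)\in\mathbf{R}_{++}$$ and $$\eta_y:=1-\sigma\left(\frac{1}{1+\mu\sigma}(L_{yx}\gamma+L_{yy}\delta)+\frac{L_{xy}}{\beta}+\frac{L_{yy}}{\delta}\right)\in\mathbf{R}_{++}.$$ Then for every $K\in\mathbf{N}\smallsetminus\{0\}$ the following hold. (i) $$0\le2\theta\sigma\left(f(\hat x_K,y^{*})-f(x^{*},\hat y_K)\right)+\eta_x\|x^{*}-x^K\|^2+\eta_y\|y^{*}-y^K\|^2\le\theta^K\left(\|x^{*}-x^0\|^2+\|y^{*}-y^0\|^2\right).$$ Consequently, $0\le f(\hat x_K,y^{*})-f(x^{*},\hat y_K)\le\frac{\theta^{K-1}}{2\sigma}\left(\|x^{*}-x^0\|^2+\|y^{*}-y^0\|^2\right)$; moreover, $\|x^{*}-x^K\|^2+\|y^{*}-y^K\|^2\le\theta^K\frac{1}{\min\{\eta_x,\eta_y\}}\left(\|x^{*}-x^0\|^2+\|y^{*}-y^0\|^2\right)$,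 that is, the sequence $((x^k,y^k))_{k\in\mathbf{N}}$ converges linearly to the saddle-point $(x^{*},y^{*})$ of $f$. (ii) $$-\frac{\theta^{K-1}}{2\sigma}\left(\|\hat x_K-x^0\|^2+\|y^{*}-y^0\|^2\right)\le f(\hat x_K,\hat y_K)-f(x^{*},y^{*})\le\frac{\theta^{K-1}}{2\sigma}\left(\|x^{*}-x^0\|^2+\|\hat y_K-y^0\|^2\right).$$ Consequently, $(f(\hat x_k,\hat y_k))_{k\ge1}$ converges linearly to $f(x^{*},y^{*})$.
   Context: $\mathbf{N}=\{0,1,2,\dots\}$, $\mathbf{R}_+=[0,\infty)$, $\mathbf{R}_{++}=(0,\infty)$; $\mathcal{H}_1,\mathcal{H}_2$ are real Hilbert spaces. Problem. $\Phi:\mathcal{H}_1\times\mathcal{H}_2\to\mathbf{R}\cup\{\pm\infty\}$, $f_i:\mathcal{H}_i\to\mathbf{R}\cup\{+\infty\}$ ($i=1,2$), and $f(x,y)=f_1(x)+\Phi(x,y)-f_2(y)$, with the convention $+\infty-(+\infty)=-\infty$; so $f(x,y)=f_1(x)+\Phi(x,y)-f_2(y)\in\mathbf{R}$ if $x\in\operatorname{dom}f_1$ and $y\in\operatorname{dom}f_2$; $f(x,y)=-\infty$ if $y\notin\operatorname{dom}f_2$; $f(x,y)=+\infty$ if $x\notin\operatorname{dom}f_1$ and $y\in\operatorname{dom}f_2$. Standing assumptions: each $f_i$ is proper, lower semicontinuous, and convex with modulus $\mu_i\ge0$ (i.e. $f_i-\frac{\mu_i}{2}\|\cdot\|^2$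 is convex); $\operatorname{dom}f_1,\operatorname{dom}f_2$ are nonempty, closed and convex; for every $y\in\operatorname{dom}f_2$, $\Phi(\cdot,y):\mathcal{H}_1\to\mathbf{R}$ is convex and Fréchet differentiable (gradient $\nabla_x\Phi$); for every $x\in\operatorname{dom}f_1$, $\Phi(x,\cdot):\mathcal{H}_2\to\mathbf{R}$ is concave and Fréchet differentiable (gradient $\nabla_y\Phi$); there are $L_{xx},L_{xy},L_{yx},L_{yy}\in\mathbf{R}_+$ such that for all $(x,y),(x',y')\in\operatorname{dom}f_1\times\operatorname{dom}f_2$, $\|\nabla_x\Phi(x,y)-\nabla_x\Phi(x',y')\|\le L_{xx}\|x-x'\|+L_{xy}\|y-y'\|$ and $\|\nabla_y\Phi(x,y)-\nabla_y\Phi(x',y')\|\le L_{yx}\|x-x'\|+L_{yy}\|y-y'\|$. Saddle-point: $(x^{*},y^{*})\in\mathcal{H}_1\times\mathcal{H}_2$ with $f(x^{*},y)\le f(x^{*},y^{*})\le f(x,y^{*})$ for all $(x,y)\in\mathcal{H}_1\times\mathcal{H}_2$ (necessarily $(x^*,y^* )\in\operatorname{dom}f_1\times\operatorname{dom}f_2$). Algorithm. $(x^0,y^0)\in\operatorname{dom}f_1\times\operatorname{dom}f_2$, $x^{-1}=x^0$, $y^{-1}=y^0$; $(\tau_k),(\sigma_k),(\lambda_k),(\theta_k)$ ($k\in\mathbf{N}$) are sequences in $\mathbf{R}_{++}$; for every $k\in\mathbf{N}$, $x^{k+1}=\operatorname{Prox}_{\tau_kf_1}\big(x^k-\tau_k((1+\lambda_k)\nabla_x\Phi(x^k,y^k)-\lambda_k\nabla_x\Phi(x^{k-1},y^{k-1}))\big)$,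 $y^{k+1}=\operatorname{Prox}_{\sigma_kf_2}\big(y^k+\sigma_k((1+\theta_k)\nabla_y\Phi(x^k,y^k)-\theta_k\nabla_y\Phi(x^{k-1},y^{k-1}))\big)$, where $\operatorname{Prox}_{g}(u)=\operatorname{argmin}_z\,g(z)+\frac12\|z-u\|^2$. All iterates lie in $\operatorname{dom}f_1\times\operatorname{dom}f_2$. For $K\in\mathbf{N}\smallsetminus\{0\}$: $\hat x_K=\frac{1}{\sum_{i=0}^{K-1}t_i}\sum_{k=0}^{K-1}t_kx^{k+1}$, $\hat y_K=\frac{1}{\sum_{i=0}^{K-1}t_i}\sum_{k=0}^{K-1}t_ky^{k+1}$. A sequence $(z_k)$ converges linearly to $z$ if there are $C\ge0$ and $q\in(0,1)$ with $\|z_k-z\|\le Cq^k$ for all $k$. *)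

(* Defs.v *)
From HB Require Import structures.
From mathcomp Require Import all_boot all_order all_algebra.
From mathcomp Require Import all_classical all_reals all_analysis.

Set Implicit Arguments.
Unset Strict Implicit.
Unset Printing Implicit Defensive.

Import Order.TTheory GRing.Theory Num.Theory.
Import numFieldNormedType.Exports.

Local Open Scope classical_set_scope.
Local Open Scope ring_scope.

(* Real Hilbert spaces: the topology is that of the complete normed module,
   and [inner_norm] says that its norm is the one induced by [inner]. *)
HB.mixin Record CompleteNormedModule_isHilbert (R : realType) V
    & CompleteNormedModule R V := {
  inner : {dot V for (@idfun R)} ;
  inner_norm : forall x : V, inner x x = `|x| ^+ 2
}.

#[short(type="hilbertType")]
HB.structure Definition Hilbert (R : realType) :=
  {V of CompleteNormedModule_isHilbert R V & CompleteNormedModule R V}.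

Section ConvexAnalysis.
Context {R : realType} {H : hilbertType R}.

(* The Riesz representative of the Frechet differential; meaningful only where
   [g] is differentiable. *)
Definition gradient (g : H -> R) (x : H) : H :=
  get [set v | forall h, 'd g x h = inner v h].

Definition dom (g : H -> \bar R) : set H := [set x | (g x < +oo)%E].

(* The first conjunct says that [g] takes its values in R \cup {+oo}. *)
Definition proper (g : H -> \bar R) : Prop :=
  (forall x, g x != -oo%E) /\ dom g !=set0.

(* Meant for functions that never take the value -oo; since 0 * +oo = 0, the
   cases t = 0 and t = 1 hold trivially. *)
Definition convex_ereal (g : H -> \bar R) : Prop :=
  forall (x y : H) (t : R), 0 <= t <= 1 ->
    (g (t *: x + (1 - t) *: y)%R <= t%:E * g x + (1 - t)%:E * g y)%E.

Definition convex_with_modulus (mu : R) (g : H -> \bar R) : Prop :=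
  convex_ereal (fun x => (g x - (mu / 2 * `|x| ^+ 2)%:E)%E).

Definition argmin (g : H -> \bar R) : set H :=
  [set z | forall w, (g z <= g w)%E].

(* The minimizer exists and is unique when [g] is proper, convex and lower
   semicontinuous. *)
Definition prox (g : H -> \bar R) (u : H) : H :=
  get (argmin (fun z => (g z + (2^-1 * `|z - u| ^+ 2)%:E)%E)).

(* \hat z_K *)
Definition weighted_average (t : nat -> R) (z : nat -> H) (K : nat) : H :=
  (\sum_(i < K) t i)^-1 *: \sum_(k < K) t k *: z k.+1.

End ConvexAnalysis.

(* Linear convergence of (z_k)_{k >= k0}. *)
Definition converges_linearly {R : realType} {T : Type} (dist : T -> T -> \bar R)
    (k0 : nat) (z : nat -> T) (l : T) : Prop :=
  exists C q : R, [/\ 0 <= C, 0 < q < 1 &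
    forall k, (k0 <= k)%N -> (dist (z k) l <= (C * q ^+ k)%:E)%E].

Definition ereal_dist {R : realType} (a b : \bar R) : \bar R := `|a - b|%E.

Section SaddlePoint.
Context {R : realType} {H1 H2 : hilbertType R}.

(* Distance of the product Hilbert space; the library's norm on H1 * H2 is the
   max norm. *)
Definition hilbert_prod_dist (z w : H1 * H2) : \bar R :=
  (Num.sqrt (`|z.1 - w.1| ^+ 2 + `|z.2 - w.2| ^+ 2))%:E.

Variables (f1 : H1 -> \bar R) (f2 : H2 -> \bar R) (Phi : H1 -> H2 -> \bar R).

(* Addition on \bar R satisfies +oo - +oo = -oo, the convention wanted here. *)
Definition objective (x : H1) (y : H2) : \bar R := (f1 x + Phi x y - f2 y)%E.

Definition saddle_point (xs : H1) (ys : H2) : Prop :=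
  forall x y, (objective xs y <= objective xs ys <= objective x ys)%E.

(* [fine] is used only where [Phi] is finite, see [Phi_fin_x], [Phi_fin_y]. *)
Definition grad_x (x : H1) (y : H2) : H1 :=
  gradient (fun u => fine (Phi u y)) x.

Definition grad_y (x : H1) (y : H2) : H2 :=
  gradient (fun v => fine (Phi x v)) y.

Record saddle_problem (mu1 mu2 Lxx Lxy Lyx Lyy : R) : Prop := SaddleProblem {
  mu1_ge0 : 0 <= mu1 ;
  mu2_ge0 : 0 <= mu2 ;
  f1_proper : proper f1 ;
  f2_proper : proper f2 ;
  f1_lsc : lower_semicontinuous f1 ;
  f2_lsc : lower_semicontinuous f2 ;
  f1_convex : convex_with_modulus mu1 f1 ;
  f2_convex : convex_with_modulus mu2 f2 ;
  dom_f1_closed : closed (dom f1) ;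
  dom_f2_closed : closed (dom f2) ;
  dom_f1_convex : convex_set (dom f1) ;
  dom_f2_convex : convex_set (dom f2) ;
  Phi_fin_x : forall y, dom f2 y -> forall x, Phi x y \is a fin_num ;
  Phi_convex : forall y, dom f2 y ->
    convex_function setT (fun x => fine (Phi x y)) ;
  Phi_diff_x : forall y, dom f2 y ->
    forall x, differentiable (fun u => fine (Phi u y)) x ;
  Phi_fin_y : forall x, dom f1 x -> forall y, Phi x y \is a fin_num ;
  Phi_concave : forall x, dom f1 x ->
    convex_function setT (fun y => - fine (Phi x y)) ;
  Phi_diff_y : forall x, dom f1 x ->
    forall y, differentiable (fun v => fine (Phi x v)) y ;
  Lxx_ge0 : 0 <= Lxx ;
  Lxy_ge0 : 0 <= Lxy ;
  Lyx_ge0 : 0 <= Lyx ;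
  Lyy_ge0 : 0 <= Lyy ;
  grad_x_lipschitz : forall x x' y y',
    dom f1 x -> dom f1 x' -> dom f2 y -> dom f2 y' ->
    `|grad_x x y - grad_x x' y'| <= Lxx * `|x - x'| + Lxy * `|y - y'| ;
  grad_y_lipschitz : forall x x' y y',
    dom f1 x -> dom f1 x' -> dom f2 y -> dom f2 y' ->
    `|grad_y x y - grad_y x' y'| <= Lyx * `|x - x'| + Lyy * `|y - y'|
}.

(* The convention x^{-1} = x^0, y^{-1} = y^0 is built in: 0.-1 = 0. *)
Record iterates (tau_ sigma_ lambda_ theta_ : nat -> R)
    (x_ : nat -> H1) (y_ : nat -> H2) : Prop := Iterates {
  x0_dom : dom f1 (x_ 0%N) ;
  y0_dom : dom f2 (y_ 0%N) ;
  tau_gt0 : forall k, 0 < tau_ k ;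
  sigma_gt0 : forall k, 0 < sigma_ k ;
  lambda_gt0 : forall k, 0 < lambda_ k ;
  theta_gt0 : forall k, 0 < theta_ k ;
  x_step : forall k, x_ k.+1 =
    prox (fun z => ((tau_ k)%:E * f1 z)%E)
      (x_ k - tau_ k *: ((1 + lambda_ k) *: grad_x (x_ k) (y_ k)
                         - lambda_ k *: grad_x (x_ k.-1) (y_ k.-1))) ;
  y_step : forall k, y_ k.+1 =
    prox (fun z => ((sigma_ k)%:E * f2 z)%E)
      (y_ k + sigma_ k *: ((1 + theta_ k) *: grad_y (x_ k) (y_ k)
                           - theta_ k *: grad_y (x_ k.-1) (y_ k.-1)))
}.

End SaddlePoint.

(* Main.v *)
Require Import Defs.
From mathcomp Require Import all_boot all_order all_algebra.
From mathcomp Require Import all_classical all_reals all_analysis.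
From mathcomp Require Import ring lra.

Set Implicit Arguments.
Unset Strict Implicit.
Unset Printing Implicit Defensive.

Import Order.TTheory GRing.Theory Num.Theory.
Import numFieldNormedType.Exports.

Local Open Scope classical_set_scope.
Local Open Scope ring_scope.

(* Fix a reference point (x, y) and let g_k, h_k be the gradients of Phi(., y^k)
   and -Phi(x^k, .) at the iterates.  Strong convexity of the two proximal
   problems, together with the convexity-concavity of Phi, yields
     2 sigma (f(x^{k+1}, y) - f(x, y^{k+1})) + V_{k+1} / theta <= V_k,
   where V_k consists of the squared distance to (x, y), of the terms
   - 2 sigma theta <g_k - g_{k-1}, x^k - x> (and its analogue in y), and of
   multiples of |x^k - x^{k-1}|^2 and |y^k - y^{k-1}|^2 absorbing the
   extrapolation error via Young's inequality; moreover V_k dominates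
   eta_x |x - x^k|^2 + eta_y |y - y^k|^2.  Summing with weights theta^-k and
   applying Jensen's inequality bounds the gap f(xhat, y) - f(x, yhat), and all
   claims follow by taking (x, y) among (x*, y* ), (xhat, y* ) and (x*, yhat).
   Existence of proximal points and the Riesz representation behind the
   gradients both come from minimizing strongly convex functions. *)

(** * Hilbert space geometry, convex minimization and gradients *)

Section Hilbert.
Context {R : realType} {H : hilbertType R}.
Implicit Types x y z u v : H.

Lemma innerC x y : inner x y = inner y x.
Proof. by rewrite hermC expr0 mul1r. Qed.

Lemma innerDl x y z : inner (x + y) z = inner x z + inner y z.
Proof. exact: linearDl. Qed.

Lemma innerDr x y z : inner z (x + y) = inner z x + inner z y.
Proof. exact: linearDr. Qed.

Lemma innerNl x y : inner (- x) y = - inner x y.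
Proof. exact: linearNl. Qed.

Lemma innerNr x y : inner x (- y) = - inner x y.
Proof. exact: linearNr. Qed.

Lemma innerZl t x y : inner (t *: x) y = t * inner x y.
Proof. by rewrite linearZl_LR. Qed.

Lemma innerZr t x y : inner x (t *: y) = t * inner x y.
Proof. by rewrite linearZr_LR. Qed.

Definition innerE := (innerDl, innerDr, innerNl, innerNr, innerZl, innerZr).

Lemma cauchy_schwarz x y : `|inner x y| <= `|x| * `|y|.
Proof.
have [->|y0] := eqVneq y 0.
  by rewrite -(scale0r (0 : H)) innerZr mul0r normr0 scale0r normr0 mulr0.
have yy0 : 0 < inner y y by rewrite inner_norm exprn_gt0 // normr_gt0.
suff h : inner x y ^+ 2 <= (`|x| * `|y|) ^+ 2.
  by rewrite -(@ler_pXn2r _ 2) // ?nnegrE ?mulr_ge0 // real_normK ?num_real.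
(* The vector is the residual of projecting [x] onto the line of [y]; its squared norm times
   [inner y y] is the defect in the inequality. *)
have := sqr_ge0 (`|x - (inner x y / inner y y) *: y|).
rewrite -inner_norm !innerE (innerC y x) exprMn -!inner_norm => h.
have : 0 <= (inner x x - inner x y ^+ 2 / inner y y) * inner y y.
  apply: mulr_ge0; last exact: ltW.
  apply: le_trans h _; rewrite le_eqVlt; apply/orP; left; apply/eqP.
  by field; rewrite gt_eqF.
rewrite mulrBl mulfVK ?gt_eqF //; lra.
Qed.

Lemma sqnormD x y : `|x + y| ^+ 2 = `|x| ^+ 2 + 2 * inner x y + `|y| ^+ 2.
Proof. by rewrite -!inner_norm !innerE (innerC y x); ring. Qed.

Lemma sqnormB x y : `|x - y| ^+ 2 = `|x| ^+ 2 - 2 * inner x y + `|y| ^+ 2.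
Proof. by rewrite sqnormD innerNr normrN; ring. Qed.

Lemma sqnorm_conv x y t :
  `|t *: x + (1 - t) *: y| ^+ 2 =
  t * `|x| ^+ 2 + (1 - t) * `|y| ^+ 2 - t * (1 - t) * `|x - y| ^+ 2.
Proof. by rewrite -!inner_norm !innerE (innerC y x); ring. Qed.

Lemma sqdist_conv u x y t :
  `|t *: x + (1 - t) *: y - u| ^+ 2 =
  t * `|x - u| ^+ 2 + (1 - t) * `|y - u| ^+ 2 - t * (1 - t) * `|x - y| ^+ 2.
Proof.
have -> : t *: x + (1 - t) *: y - u = t *: (x - u) + (1 - t) *: (y - u).
  by rewrite !scalerBr addrACA -opprD -scalerDl (addrC t) subrK scale1r.
by rewrite sqnorm_conv opprB addrA subrK.
Qed.

Lemma sqdistD_le x y z :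
  `|x - z| ^+ 2 <= 2 * `|x - y| ^+ 2 + 2 * `|y - z| ^+ 2.
Proof.
rewrite -[x - z](subrKA y); have := sqr_ge0 `|(x - y) - (y - z)|.
by rewrite (sqnormB (x - y)) (sqnormD (x - y)); lra.
Qed.

(** The pair ([D], [F]) encodes the extension of [F] by +oo outside [D], so convexity of [D] is part
    of the notion; [m = 0] is plain convexity. *)
Definition strongly_convex_on (D : set H) (m : R) (F : H -> R) :=
  forall x y t, D x -> D y -> 0 <= t <= 1 ->
    D (t *: x + (1 - t) *: y) /\
    F (t *: x + (1 - t) *: y) <=
      t * F x + (1 - t) * F y - m / 2 * (t * (1 - t) * `|x - y| ^+ 2).

Lemma strongly_convex_on0 (D : set H) (m : R) (F : H -> R) :
  0 <= m -> strongly_convex_on D m F -> strongly_convex_on D 0 F.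
Proof.
move=> m0 cF x y t Dx Dy t1; have [Dw hw] := cF x y t Dx Dy t1; split => //.
apply: le_trans hw _; rewrite lerD2l lerN2 mul0r mul0r mulr_ge0 ?divr_ge0 //.
by case/andP: t1 => t0 t1; rewrite !mulr_ge0 // subr_ge0.
Qed.

(* Lower semicontinuity of the extension of [F] by +oo outside [D]. *)
Definition lsc_on (D : set H) (F : H -> R) :=
  forall z a, (D z -> a < F z) -> \forall w \near z, D w -> a < F w.

Lemma lsc_onD (D : set H) (F q : H -> R) :
  lsc_on D F -> continuous q -> lsc_on D (fun z => F z + q z).
Proof.
move=> lF cq z a az.
have [Dz|nDz] := pselect (D z).
  set e := (F z + q z - a) / 2.
  have e0 : 0 < e by rewrite divr_gt0 // subr_gt0 az.
  have h1 := lF z (F z - e) (fun _ => ltac:(lra)).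
  have /cvgrPdist_lt/(_ e e0) h2 := cq z.
  near=> w => Dw.
  have : F z - e < F w by move: Dw; near: w.
  have : `|q z - q w| < e by near: w.
  by rewrite ltr_norml /e => /andP[_ A] B; move: A B; lra.
(* At a point outside [D] the premise of [lsc_on] is vacuous, so [F] eventually exceeds any chosen
   level on [D]; the extra 1 pays for the oscillation of [q]. *)
have h1 := lF z (a - q z + 1) (fun Dz => False_ind _ (nDz Dz)).
have /cvgrPdist_lt/(_ 1 ltr01) h2 := cq z.
near=> w => Dw.
have : a - q z + 1 < F w by move: Dw; near: w.
have : `|q z - q w| < 1 by near: w.
by rewrite ltr_norml => /andP[_ A] B; move: A B; lra.
Unshelve. all: by end_near. Qed.

Lemma sqdist_continuous u : continuous (fun z : H => 2^-1 * `|z - u| ^+ 2).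
Proof.
move=> z; apply: cvgM; first exact: cvg_cst.
rewrite /=; under eq_fun do rewrite expr2.
have c : `|w - u| @[w --> z] --> `|z - u|.
  by apply: cvg_norm; apply: cvgB; [exact: cvg_id|exact: cvg_cst].
by rewrite expr2; apply: cvgM.
Qed.

Lemma strongly_convex_on_minimizer (D : set H) (m b : R) (G : H -> R) :
  0 < m -> D !=set0 -> strongly_convex_on D m G -> lsc_on D G ->
  (forall z, D z -> b <= G z) ->
  exists2 p, D p & forall w, D w -> G p + m / 2 * `|w - p| ^+ 2 <= G w.
Proof.
(* Strong convexity at midpoints makes minimizing sequences Cauchy. *)
move=> m0 [z0 Dz0] cG lG bG.
set S := [set G z | z in D]; set I := inf S.
have infS : has_inf S.
  by split; [exists (G z0); exists z0|exists b => _ [z Dz <-]; exact: bG].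
have IG z : D z -> I <= G z by move=> Dz; apply: ge_inf; [case: infS|exists z].
have /choice [z zP] n : exists z, D z /\ G z < I + n.+1%:R^-1.
  have n0 : 0 < n.+1%:R^-1 :> R by rewrite invr_gt0.
  have [_ [z Dz <-] h] := inf_adherent n0 infS.
  by exists z.
have half : 0 <= (2^-1 : R) <= 1 by lra.
(* The 8 is the inverse of 1/2 times 1/4, from [m / 2] and [t * (1 - t)] at the midpoint. *)
have close x y e : D x -> D y -> G x <= I + e -> G y <= I + e ->
    `|x - y| ^+ 2 <= 8 * e / m.
  move=> Dx Dy hx hy; have [Dw hw] := cG x y 2^-1 Dx Dy half.
  have := IG _ Dw; rewrite ler_pdivlMr // => h.
  move: hw h hx hy; set N := _ ^+ 2; set g := G (_ + _). lra.
have : cauchy (z @ \oo).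
  apply: cauchy_exP => e e0.
  have k0 : 0 < m * e ^+ 2 / 8 by rewrite divr_gt0 // mulr_gt0 // exprn_gt0.
  have [N NP] : exists N : nat, N.+1%:R^-1 < m * e ^+ 2 / 8.
    have [N _ /(_ N (leqnn N)) h] := near_infty_natSinv_lt (PosNum k0).
    by exists N.
  exists (z N); exists N => // n /= Nn.
  rewrite -ball_normE /ball_ /=.
  have [[DN GN] [Dn Gn]] := (zP N, zP n).
  have := close (z N) (z n) N.+1%:R^-1 DN Dn (ltW GN).
  have hn : G (z n) <= I + N.+1%:R^-1.
    apply: (le_trans (ltW Gn)); rewrite lerD2l.
    by rewrite lef_pV2 ?posrE // ler_nat.
  move=> /(_ hn) h; rewrite -(@ltr_pXn2r _ 2) ?nnegrE //; last exact: ltW.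
  apply: le_lt_trans h _; rewrite ltr_pdivrMr //; move: NP; set v := _^-1; lra.
move=> /cauchy_cvg zc; set p := lim (z @ \oo) in zc.
have Gp : D p /\ G p <= I.
  (* This single exclusion gives both claims: a level [I + 1] is forbidden if [p] lies outside [D],
     and the mean of [I] and [G p] is forbidden if [G p] exceeds [I]. *)
  suff h a : ~ (I < a /\ (D p -> a < G p)).
    have Dp : D p by apply: contrapT => nDp; apply: (h (I + 1)); split => //; lra.
    split => //; rewrite leNgt; apply/negP => hl.
    by apply: (h ((I + G p) / 2)); split => [|_]; lra.
  move=> [Ia /lG ap].
  have e0 : 0 < a - I by rewrite subr_gt0.
  have h1 : \forall n \near \oo, D (z n) -> a < G (z n) := zc _ ap.
  have h2 := near_infty_natSinv_lt (PosNum e0).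
  near \oo => n.
  have [Dn hn] := zP n.
  have : a < G (z n) by move: Dn; near: n.
  have : n.+1%:R^-1 < a - I by near: n.
  by move: hn; set v := _^-1; lra.
exists p; first exact: Gp.1.
move=> w Dw; rewrite leNgt; apply/negP => hl.
have G0 : G p <= G w by apply: le_trans Gp.2 (IG _ Dw).
have N0 := sqr_ge0 `|w - p|.
set N := `|w - p| ^+ 2 in hl N0 *.
pose d := m / 2 * N - (G w - G p).
have d0 : 0 < d by rewrite /d; lra.
have mN0 : 0 < m / 2 * N by rewrite /d in d0; lra.
have M0 : 0 < m * N by lra.
(* If quadratic growth failed by [d], moving from [p] a fraction [t] of the way to [w] would change
   [G] by at most t (- d + t m N / 2) = - t d / 2, contradicting minimality. *)
pose t := d / (m * N).
have tE : t * (m * N) = d by rewrite /t mulfVK // gt_eqF.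
have t0 : 0 < t by exact: divr_gt0.
have t1 : 0 <= t <= 1 by rewrite ltW //= /t ler_pdivrMr // /d; lra.
have [Dt ht] := cG w p t Dw Gp.1 t1.
have := le_trans Gp.2 (IG _ Dt) => h.
have := le_trans h ht; rewrite -/N => {h ht} h.
have : 0 <= t * (G w - G p - m / 2 * N * (1 - t)) by move: h; lra.
by rewrite pmulr_rge0 // /d in tE d0 *; lra.
Unshelve. all: by end_near. Qed.

(** Lower semicontinuity bounds [F] below by [F x0 - 1] on a ball of radius [r]; convexity along
    segments from [x0] extends this to a downward cone of slope [2 / r]. *)
Lemma convex_lsc_minorant (D : set H) (F : H -> R) x0 :
  strongly_convex_on D 0 F -> lsc_on D F -> D x0 ->
  exists2 c, 0 <= c & forall z, D z -> F x0 - 1 - c * `|z - x0| <= F z.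
Proof.
move=> cF lF D0.
have /nbhs_normP[r /= r0 hr] := lF x0 (F x0 - 1) (fun _ => ltac:(lra)).
exists (2 / r); first by rewrite divr_ge0 // ltW.
move=> z Dz; set d := `|z - x0|.
have d0 : 0 <= d by exact: normr_ge0.
have cd0 : 0 <= 2 / r * d by rewrite mulr_ge0 // divr_ge0 // ltW.
have [dr|rd] := ltP d r.
  have : F x0 - 1 < F z by apply: hr => //=; rewrite distrC.
  lra.
have dp : 0 < d by exact: lt_le_trans r0 rd.
(* This puts the intermediate point at distance [r / 2] from [x0], inside the ball. *)
pose s := r / (2 * d).
have s0 : 0 < s by rewrite divr_gt0 // mulr_gt0.
have sE : s * (2 / r * d) = 1 by rewrite /s; field; rewrite !gt_eqF.
have s1 : 0 <= s <= 1 by rewrite ltW //= /s ler_pdivrMr ?mulr_gt0 // mul1r; lra.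
have [Dw hw] := cF z x0 s Dz D0 s1.
have : F x0 - 1 < F (s *: z + (1 - s) *: x0).
  apply: hr => //=.
  have -> : x0 - (s *: z + (1 - s) *: x0) = s *: (x0 - z).
    by rewrite scalerBr scalerBl scale1r opprD opprB addrC -addrA subrK addrC.
  rewrite normrZ gtr0_norm // distrC -/d /s.
  by rewrite invfM mulrA mulfVK ?gt_eqF // ltr_pdivrMr //; lra.
move: hw; rewrite mul0r mul0r subr0 => hw h.
have : 0 <= s * (F z - F x0 + 1 * (2 / r * d)).
  by rewrite mulrDr mul1r sE; lra.
rewrite pmulr_rge0 // mul1r; lra.
Qed.

(** The quadratic term raises the modulus to [1 + m] and dominates the cone minorant, so
    [strongly_convex_on_minimizer] applies. *)
Lemma prox_exists (D : set H) (m : R) (F : H -> R) u :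
  0 <= m -> D !=set0 -> strongly_convex_on D m F -> lsc_on D F ->
  exists2 p, D p & forall w, D w ->
    F p + 2^-1 * `|p - u| ^+ 2 + (1 + m) / 2 * `|w - p| ^+ 2
    <= F w + 2^-1 * `|w - u| ^+ 2.
Proof.
move=> m0 [x0 D0] cF lF.
have [c c0 hc] := convex_lsc_minorant (strongly_convex_on0 m0 cF) lF D0.
(* The lower bound comes from s^2 / 2 - c s >= - c^2 / 2 with s = |z - u|. *)
apply: (@strongly_convex_on_minimizer D (1 + m)
  (F x0 - 1 - c * `|u - x0| - c ^+ 2 / 2) (fun z => F z + 2^-1 * `|z - u| ^+ 2)).
- lra.
- by exists x0.
- move=> x y t Dx Dy t1; have [Dw hw] := cF x y t Dx Dy t1; split => //.
  rewrite sqdist_conv; move: hw; set A := F _; lra.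
- by apply: lsc_onD => //; exact: sqdist_continuous.
- move=> z /hc h; have hn : `|z - x0| <= `|z - u| + `|u - x0|.
    by rewrite -[z - x0](subrKA u); exact: ler_normD.
  have : 0 <= (`|z - u| - c) ^+ 2 by exact: sqr_ge0.
  have : c * `|z - x0| <= c * (`|z - u| + `|u - x0|) by rewrite ler_wpM2l.
  move: h; rewrite !expr2; lra.
Qed.

(* The proximal point p of the linear form l at 0 satisfies l = - <p, .>. *)
Lemma riesz (l : {linear H -> R}) :
  continuous l -> exists v, forall h, l h = inner v h.
Proof.
move=> cl.
have [||||p _ hp] := @prox_exists setT 0 l 0.
- by [].
- by exists 0.
- move=> x y t _ _ _; split => //.
  have -> : l (t *: x + (1 - t) *: y) = t * l x + (1 - t) * l y.
    by rewrite linearD !linearZ.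
  by rewrite mul0r mul0r subr0.
- move=> z a /(_ I) az; have /cvgrPdist_lt/(_ (l z - a)) := cl z.
  rewrite subr_gt0 => /(_ az) h; near=> w => _.
  have : `|l z - l w| < l z - a by near: w.
  by rewrite ltr_norml => /andP[_]; lra.
(* The growth term at [p] cancels |h|^2 / 2 exactly, leaving an inequality linear in [h]; using it
   for [h] and [- h] gives equality. *)
have h1 h : 0 <= l h + inner p h.
  have lD : l (p + h) = l p + l h by exact: linearD.
  have phK : p + h - p = h by rewrite addrAC subrr add0r.
  have := hp (p + h) I; rewrite phK lD !subr0 addr0 sqnormD; lra.
exists (- p) => h; rewrite innerNl; apply/eqP; rewrite eq_le.
have lN : l (- h) = - l h by exact: linearN.
have := h1 h; have := h1 (- h); rewrite innerNr lN.
by move=> A B; apply/andP; split; lra.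
Unshelve. all: by end_near. Qed.

Lemma gradientP (g : H -> R) x :
  differentiable g x -> forall h, 'd g x h = inner (gradient g x) h.
Proof.
move=> dg; rewrite /gradient.
case: xgetP => [v _ //|].
have [v vP] := riesz (diff_continuous dg).
by move=> /(_ v) /(_ vP).
Qed.

Lemma convex_functionT (g : H -> R) : convex_function setT g ->
  forall x y t, 0 <= t <= 1 ->
    g (t *: x + (1 - t) *: y) <= t * g x + (1 - t) * g y.
Proof.
move=> cg x y t /andP[t0 t1].
exact: (cg (Itv01 t0 t1) x y (mem_set I) (mem_set I)).
Qed.

Lemma convex_function_strongly_convex_on (g : H -> R) :
  convex_function setT g -> strongly_convex_on setT 0 g.
Proof.
move=> cg x y t _ _ t01; split => //.
by rewrite mul0r mul0r subr0; exact: convex_functionT.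
Qed.

Lemma sqdist_convex u : strongly_convex_on setT 0 (fun z => `|z - u| ^+ 2).
Proof.
move=> x y t _ _ /andP[t0 t1]; split => //.
rewrite sqdist_conv mul0r mul0r lerD2l lerN2.
by rewrite !mulr_ge0 // subr_ge0.
Qed.

(** The directional derivative is a limit from the right of difference quotients, and convexity
    bounds each quotient with step at most 1 by [g y - g x]. *)
Lemma convex_diff_le (g : H -> R) x y :
  convex_function setT g -> differentiable g x -> 'd g x (y - x) <= g y - g x.
Proof.
move=> cg dg; rewrite -deriveE //.
have /cvg_dnbhs_at_right der := diff_derivable (v := y - x) dg.
apply: (cvgr_to_le der).
near=> h => /=.
have h0 : 0 < h by near: h; exact: nbhs_right_gt.
have h1 : h <= 1 by near: h; exact: nbhs_right_le.
have t01 : 0 <= h <= 1 by rewrite ltW.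
have := convex_functionT cg y x t01.
have -> : h *: y + (1 - h) *: x = h *: (y - x) + x.
  by rewrite scalerBr scalerBl scale1r addrA addrAC.
move=> hg; rewrite ler_pdivrMl //.
by move: hg; set a := g (_ + _); lra.
Unshelve. all: by end_near. Qed.

Lemma convex_gradient_le (g : H -> R) x y :
  convex_function setT g -> differentiable g x ->
  g x + inner (gradient g x) (y - x) <= g y.
Proof. by move=> cg dg; rewrite -gradientP // addrC -lerBrDr convex_diff_le. Qed.

Lemma concave_gradient_ge (g : H -> R) x y :
  convex_function setT (fun z => - g z) -> differentiable g x ->
  g y <= g x + inner (gradient g x) (y - x).
Proof.
move=> cg dg; rewrite -gradientP //.
have := convex_diff_le y cg (differentiableN dg).
rewrite (_ : (fun z => - g z) = - g) // diffN //= opprK.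
rewrite [X in X <= _](_ : _ = - 'd g x (y - x)) //; lra.
Qed.

End Hilbert.

(** * Weighted averages and the proximal step *)

Section Proximal.
Context {R : realType} {H : hilbertType R}.

(** Jensen's inequality by induction: the next average is the convex combination of the previous one
    and the new point with weight [S / (S + t K.+1)]. *)
Lemma weighted_average_convex (D : set H) (F : H -> R) (t : nat -> R)
    (z : nat -> H) :
  strongly_convex_on D 0 F -> (forall k, 0 < t k) -> (forall k, D (z k)) ->
  forall K, D (weighted_average t z K.+1) /\
    (\sum_(i < K.+1) t i) * F (weighted_average t z K.+1)
    <= \sum_(k < K.+1) t k * F (z k.+1).
Proof.
move=> cF t0 Dz; elim=> [|K [DA hA]].
  rewrite /weighted_average !big_ord1 scalerA mulVf ?gt_eqF //.
  by rewrite scale1r.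
rewrite big_ord_recr [in X in _ <= X]big_ord_recr /=.
set S := \sum_(i < K.+1) t i in hA *.
have S0 : 0 < S.
  by rewrite /S big_ord_recr /= ltr_wpDl // sumr_ge0 // => i _; exact: ltW.
set A := weighted_average t z K.+1 in DA hA.
set s := S / (S + t K.+1).
have Stp : 0 < S + t K.+1 by exact: addr_gt0.
have s01 : 0 <= s <= 1.
  apply/andP; split; first by rewrite divr_ge0 // ltW.
  by rewrite ler_pdivrMr // mul1r lerDl ltW.
have -> : weighted_average t z K.+2 = s *: A + (1 - s) *: z K.+2.
  rewrite /weighted_average big_ord_recr [in X in _ *: X]big_ord_recr /= -/S.
  rewrite scalerDr; congr (_ + _); last first.
    rewrite scalerA; congr (_ *: _).
    by rewrite /s; field; rewrite gt_eqF.
  rewrite /A /weighted_average -/S scalerA; congr (_ *: _).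
  by rewrite /s; field; rewrite !gt_eqF.
have [DB hB] := cF A (z K.+2) s DA (Dz _) s01; split => //.
move: hB; rewrite mul0r mul0r subr0 -(ler_pM2l Stp) => hB.
apply: le_trans hB _.
set a := F A in hA *; set b := F (z K.+2).
suff -> : (S + t K.+1) * (s * a + (1 - s) * b) = S * a + t K.+1 * b.
  by rewrite lerD2r.
by rewrite /s; field; rewrite gt_eqF.
Qed.

(** Jensen for the squared distance: averages stay in any ball that contains the sequence. *)
Lemma weighted_average_sqdist_le (t : nat -> R) (z : nat -> H) u M :
  (forall k, 0 < t k) -> (forall k, `|z k - u| ^+ 2 <= M) ->
  forall K, `|weighted_average t z K.+1 - u| ^+ 2 <= M.
Proof.
move=> t0 hM K.
have [_] := weighted_average_convex (sqdist_convex u) t0 (fun k => I : setT (z k)) K.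
set S := \sum_(i < K.+1) t i => h.
have S0 : 0 < S.
  by rewrite /S big_ord_recr /= ltr_wpDl // sumr_ge0 // => i _; exact: ltW.
rewrite -(ler_pM2l S0); apply: le_trans h _.
by rewrite mulr_suml ler_sum // => k _; rewrite ler_pM2l.
Qed.

Context (f : H -> \bar R) (m : R).
Hypotheses (pf : Defs.proper f) (lf : lower_semicontinuous f)
  (cf : convex_with_modulus m f).

Lemma dom_fineK x : dom f x -> (fine (f x))%:E = f x.
Proof.
move=> fx; rewrite fineK // fin_numE.
by rewrite (proj1 pf) /= lt_eqF.
Qed.

(** The extended-real inequality has a finite right-hand side, which forces the combination into
    [dom f]; [sqnorm_conv] then turns the subtracted squares into the modulus term. *)
Lemma dom_strongly_convex_on : strongly_convex_on (dom f) m (fine \o f).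
Proof.
move=> x y t Dx Dy t01.
have := cf x y t01; set z := t *: x + _.
rewrite -(dom_fineK Dx) -(dom_fineK Dy) -!EFinB -!EFinM -EFinD.
rewrite leeBlDr // -EFinD => hz.
have Dz : dom f z by apply: le_lt_trans hz _; rewrite ltry.
split => //; move: hz; rewrite -(dom_fineK Dz) lee_fin /= /z sqnorm_conv.
by rewrite -/z; lra.
Qed.

Lemma dom_lsc_on : lsc_on (dom f) (fine \o f).
Proof.
move=> z a az.
have [|V Vz hV] := lf (x := z) (a := a).
  have [Dz|] := pselect (dom f z); first by rewrite -dom_fineK // lte_fin; exact: az.
  by move=> /negP; rewrite -leNgt leye_eq => /eqP ->; rewrite ltry.
apply: filterS Vz => w Vw Dw.
by have := hV w Vw; rewrite -dom_fineK // lte_fin.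
Qed.

(** The point chosen by [get] minimizes the extended-real objective, hence lies in [dom f], and
    quadratic growth at the minimizer [q] of [prox_exists] makes it equal to [q]. *)
Lemma prox_spec tau u (p := prox (fun z => (tau%:E * f z)%E) u) :
  0 <= m -> 0 < tau ->
  dom f p /\ forall w, dom f w ->
    tau * fine (f p) + 2^-1 * `|p - u| ^+ 2
      + (1 + tau * m) / 2 * `|w - p| ^+ 2
    <= tau * fine (f w) + 2^-1 * `|w - u| ^+ 2.
Proof.
move=> m0 tau0.
have cF : strongly_convex_on (dom f) (tau * m) (fun z => tau * fine (f z)).
  move=> x y t Dx Dy t01; have [Dz hz] := dom_strongly_convex_on Dx Dy t01.
  split => //; have /= := hz; rewrite -(ler_pM2l tau0); lra.
have lF : lsc_on (dom f) (fun z => tau * fine (f z)).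
  move=> z a az.
  have az' : dom f z -> a / tau < (fine \o f) z.
    by move=> Dz; rewrite ltr_pdivrMr // mulrC az.
  apply: filterS (dom_lsc_on az') => w h Dw.
  by have := h Dw; rewrite ltr_pdivrMr // mulrC.
have [q Dq hq] := prox_exists u (mulr_ge0 (ltW tau0) m0) (proj2 pf) cF lF.
suff -> : p = q by [].
set G := fun z => (tau%:E * f z + (2^-1 * `|z - u| ^+ 2)%:E)%E.
have GE w : dom f w -> G w = (tau * fine (f w) + 2^-1 * `|w - u| ^+ 2)%:E.
  by move=> Dw; rewrite /G -(dom_fineK Dw).
have Gq w : ((tau * fine (f q) + 2^-1 * `|q - u| ^+ 2)%:E <= G w)%E.
  have [Dw|] := pselect (dom f w).
    rewrite GE // lee_fin; apply: le_trans (hq w Dw).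
    by rewrite lerDl mulr_ge0 ?sqr_ge0 // divr_ge0 // addr_ge0 // mulr_ge0 // ltW.
  move=> /negP; rewrite -leNgt leye_eq => /eqP fw.
  by rewrite /G fw gt0_muley // leey.
rewrite /p /prox; case: xgetP => [z _ hz|/(_ q) nq]; last first.
  by exfalso; apply: nq => w; rewrite -/(G q) GE //; exact: Gq.
have Gz : (G z <= (tau * fine (f q) + 2^-1 * `|q - u| ^+ 2)%:E)%E.
  by rewrite -GE //; exact: hz.
have Dz : dom f z.
  have : (G z < +oo)%E by apply: le_lt_trans Gz _; rewrite ltry.
  rewrite /G /dom /=; case: (f z) => [r _|h|_]; [exact: ltry| |exact: ltNye].
  by move: h; rewrite gt0_muley.
rewrite GE // lee_fin in Gz.
have := le_trans (hq z Dz) Gz.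
rewrite gerDl pmulr_rle0; last by rewrite divr_gt0 // ltr_wpDr // mulr_ge0 // ltW.
by rewrite exprn_even_le0 //= normr_eq0 subr_eq0 => /eqP.
Qed.

(* With [g0], [g1], [g2] the gradients at the iterates k-1, k, k+1, the gradient
   extrapolated from [g0] and [g1] is written as g2 - (g2 - g1) + theta (g1 - g0)
   so that the error terms telescope. *)
Lemma prox_step sigma mu theta x0 w g0 g1 g2
  (p := prox (fun z => (sigma%:E * f z)%E)
          (x0 - sigma *: ((1 + theta) *: g1 - theta *: g0))) :
  0 < sigma -> 0 <= mu <= m -> theta^-1 = 1 + mu * sigma -> dom f w ->
  2 * sigma * (fine (f p) - fine (f w) + inner g2 (p - w))
    + theta^-1 * `|w - p| ^+ 2 + `|p - x0| ^+ 2
    - 2 * sigma * inner (g2 - g1) (p - w)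
  <= `|w - x0| ^+ 2 - 2 * sigma * theta * inner (g1 - g0) (x0 - w)
     + 2 * sigma * theta * inner (g1 - g0) (x0 - p).
Proof.
move=> s0 /andP[mu0 mum] thE Dw.
have [_ /(_ w Dw)] := prox_spec (x0 - sigma *: ((1 + theta) *: g1 - theta *: g0))
  (le_trans mu0 mum) s0.
rewrite -/p; set v := _ - theta *: g0.
(* Expanding around [x0] isolates the term in |v|^2, which is the same for [p] and [w] and
   cancels. *)
have sq z : `|z - (x0 - sigma *: v)| ^+ 2 =
    `|z - x0| ^+ 2 + 2 * sigma * inner v (z - x0) + sigma ^+ 2 * `|v| ^+ 2.
  rewrite opprB addrA addrAC sqnormD innerZr innerC normrZ exprMn gtr0_norm //.
  by ring.
rewrite !sq thE => h.
have : (1 + mu * sigma) * `|w - p| ^+ 2 <= (1 + sigma * m) * `|w - p| ^+ 2.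
  by rewrite ler_wpM2r ?sqr_ge0 // lerD2l mulrC ler_pM2l.
move: h; rewrite /v !innerE; lra.
Qed.

End Proximal.

(** * Scalar inequalities *)

Lemma young (R : realFieldType) (a c e : R) :
  0 < e -> 2 * (a * c) <= a ^+ 2 / e + e * c ^+ 2.
Proof.
move=> e0; have := sqr_ge0 (a - e * c).
rewrite -(pmulr_lge0 _ (_ : 0 < e^-1)) ?invr_gt0 // => h.
rewrite -subr_ge0; apply: le_trans h _; rewrite le_eqVlt; apply/orP; left.
by apply/eqP; field; rewrite gt_eqF.
Qed.

(* [F], [G], [P] are values of f1, f2, Phi; [X], [Y] squared distances from the
   iterates to the reference point; [dx], [dy] squared step lengths; [gx], [cx],
   [ex] inner products with, in turn, the new gradient, the gradient differences
   of [lyapunov], and the extrapolation term.  Primes denote the next iterate. *)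
Lemma descent_arith (R : realFieldType)
    (sigma theta thetaV A11 A12 A21 A22 B1 B2 : R)
    (F F' G G' P P1 P2 X X' Y Y' dx dx' dy dy' : R)
    (cx cx' ex gx cy cy' ey gy : R) :
  0 < sigma -> 0 < theta ->
  2 * sigma * (F' - F + gx) + thetaV * X' + dx' - 2 * sigma * cx'
    <= X - 2 * sigma * theta * cx + 2 * sigma * theta * ex ->
  2 * sigma * (G' - G + gy) + thetaV * Y' + dy' - 2 * sigma * cy'
    <= Y - 2 * sigma * theta * cy + 2 * sigma * theta * ey ->
  P - gx <= P1 -> P2 <= P + gy ->
  2 * ex <= A11 * dx + A12 * dy + B1 * dx' ->
  2 * ey <= A21 * dx + A22 * dy + B2 * dy' ->
  0 <= (1 - sigma * (theta * B1 + A11 + A21)) * dx' ->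
  0 <= (1 - sigma * (theta * B2 + A12 + A22)) * dy' ->
  2 * sigma * (F' + P2 - G - (F + P1 - G'))
    + (thetaV * (X' + Y') - 2 * sigma * (cx' + cy')
       + sigma * ((A11 + A21) * dx' + (A12 + A22) * dy'))
  <= X + Y - 2 * sigma * theta * (cx + cy)
     + theta * sigma * ((A11 + A21) * dx + (A12 + A22) * dy).
Proof.
move=> s0 t0 px py gxP gyP.
have st0 := mulr_ge0 (ltW s0) (ltW t0).
move=> /(ler_wpM2l st0) nx /(ler_wpM2l st0) ny ex0 ey0.
have := ler_wpM2l (ltW s0) gxP; have := ler_wpM2l (ltW s0) gyP.
lra.
Qed.

(** * Lyapunov descent along the iterates and ergodic gap bounds *)

Section Descent.
Context {R : realType} {H1 H2 : hilbertType R}.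
Context (f1 : H1 -> \bar R) (f2 : H2 -> \bar R) (Phi : H1 -> H2 -> \bar R).
Context (mu1 mu2 Lxx Lxy Lyx Lyy : R).
Hypothesis hprob : saddle_problem f1 f2 Phi mu1 mu2 Lxx Lxy Lyx Lyy.

Definition real_objective x y := fine (f1 x) + fine (Phi x y) - fine (f2 y).

Lemma objectiveE x y : dom f1 x -> dom f2 y ->
  objective f1 f2 Phi x y = (real_objective x y)%:E.
Proof.
move=> Dx Dy; rewrite /objective /real_objective EFinB EFinD.
rewrite (dom_fineK (f1_proper hprob)) // (dom_fineK (f2_proper hprob)) //.
by rewrite fineK // (Phi_fin_x hprob).
Qed.

(** Outside [dom f2] the saddle value would be -oo, yet it dominates a value above -oo; then outside
    [dom f1] it would be +oo, yet it is below a finite value. *)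
Lemma saddle_point_dom xs ys :
  saddle_point f1 f2 Phi xs ys -> dom f1 xs /\ dom f2 ys.
Proof.
move=> hs.
have [p1 [x0 Dx0]] := f1_proper hprob.
have [p2 [y0 Dy0]] := f2_proper hprob.
have Dys : dom f2 ys.
  apply: contrapT => /negP; rewrite -leNgt leye_eq => /eqP fy.
  have /andP[+ _] := hs x0 y0.
  have -> : objective f1 f2 Phi xs ys = -oo%E by rewrite /objective fy addeNy.
  have := Phi_fin_x hprob Dy0 xs.
  rewrite leeNy_eq /objective -(dom_fineK (f2_proper hprob) Dy0).
  by have := p1 xs; case: (f1 xs) => // [a|]; case: (Phi xs y0).
split=> //; apply: contrapT => /negP; rewrite -leNgt leye_eq => /eqP fx.
have /andP[_] := hs x0 y0.
rewrite (objectiveE Dx0 Dys) /objective fx -(dom_fineK (f2_proper hprob) Dys).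
by have := Phi_fin_x hprob Dys xs; case: (Phi xs ys).
Qed.

Context (mu sigma theta : R) (x_ : nat -> H1) (y_ : nat -> H2).
Hypotheses (mu_gt0 : 0 < mu) (mu_le1 : mu <= mu1) (mu_le2 : mu <= mu2).
Hypotheses (sigma_gt0 : 0 < sigma) (thetaV : theta^-1 = 1 + mu * sigma).
Hypothesis hiter : iterates f1 f2 Phi (fun=> sigma) (fun=> sigma)
  (fun=> theta) (fun=> theta) x_ y_.

Let theta_gt0 : 0 < theta.
Proof. by rewrite -invr_gt0 thetaV addr_gt0 // mulr_gt0. Qed.

Lemma x_dom k : dom f1 (x_ k).
Proof.
case: k => [|k]; first exact: x0_dom hiter.
rewrite (x_step hiter); exact: (proj1 (prox_spec (f1_proper hprob)
  (f1_lsc hprob) (f1_convex hprob) _ (mu1_ge0 hprob) sigma_gt0)).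
Qed.

Lemma y_dom k : dom f2 (y_ k).
Proof.
case: k => [|k]; first exact: y0_dom hiter.
rewrite (y_step hiter); exact: (proj1 (prox_spec (f2_proper hprob)
  (f2_lsc hprob) (f2_convex hprob) _ (mu2_ge0 hprob) sigma_gt0)).
Qed.

Let g k := grad_x Phi (x_ k) (y_ k).
(* Since y is the maximizing player, its steps are descent steps along h. *)
Let h k := - grad_y Phi (x_ k) (y_ k).

Let dx k := `|x_ k - x_ k.-1|.
Let dy k := `|y_ k - y_ k.-1|.

Context (alpha beta gamma delta : R).
Hypotheses (alpha_gt0 : 0 < alpha) (beta_gt0 : 0 < beta)
  (gamma_gt0 : 0 < gamma) (delta_gt0 : 0 < delta).

(** Cauchy-Schwarz and the Lipschitz bound, then Young's inequality with weight [alpha] on the [Lxx]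
    part and [beta] on the [Lxy] part. *)
Let extrapolation_x k v :
  2 * inner (g k - g k.-1) v
  <= (Lxx / alpha * dx k ^+ 2 + Lxy / beta * dy k ^+ 2)
     + (Lxx * alpha + Lxy * beta) * `|v| ^+ 2.
Proof.
have := grad_x_lipschitz hprob (x_dom k) (x_dom k.-1) (y_dom k) (y_dom k.-1).
rewrite -/(g k) -/(g k.-1) -/(dx k) -/(dy k) => hL.
have hv := ler_wpM2r (normr_ge0 v) hL.
have cs := le_trans (ler_norm _) (cauchy_schwarz (g k - g k.-1) v).
have := ler_wpM2l (Lxx_ge0 hprob) (young (dx k) `|v| alpha_gt0).
have := ler_wpM2l (Lxy_ge0 hprob) (young (dy k) `|v| beta_gt0).
move: hv cs; rewrite mulrDl; lra.
Qed.

Let extrapolation_y k v :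
  2 * inner (h k - h k.-1) v
  <= (Lyx / gamma * dx k ^+ 2 + Lyy / delta * dy k ^+ 2)
     + (Lyx * gamma + Lyy * delta) * `|v| ^+ 2.
Proof.
have := grad_y_lipschitz hprob (x_dom k) (x_dom k.-1) (y_dom k) (y_dom k.-1).
rewrite -normrN opprD -/(h k) opprK -[X in h k + X]opprK -/(h k.-1).
rewrite -/(dx k) -/(dy k) => hL.
have hv := ler_wpM2r (normr_ge0 v) hL.
have cs := le_trans (ler_norm _) (cauchy_schwarz (h k - h k.-1) v).
have := ler_wpM2l (Lyx_ge0 hprob) (young (dx k) `|v| gamma_gt0).
have := ler_wpM2l (Lyy_ge0 hprob) (young (dy k) `|v| delta_gt0).
move: hv cs; rewrite mulrDl; lra.
Qed.

Let eta_x := 1 - sigma * (theta * (Lxx * alpha + Lxy * beta)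
  + Lxx / alpha + Lyx / gamma).
Let eta_y := 1 - sigma * (theta * (Lyx * gamma + Lyy * delta)
  + Lxy / beta + Lyy / delta).
Hypotheses (eta_x_gt0 : 0 < eta_x) (eta_y_gt0 : 0 < eta_y).

Context (x : H1) (y : H2).
Hypotheses (Dx : dom f1 x) (Dy : dom f2 y).

(** This is V_k. The step coefficients add up those of [extrapolation_x] and [extrapolation_y], so
    that they absorb the inner products. *)
Let lyapunov k :=
  `|x - x_ k| ^+ 2 + `|y - y_ k| ^+ 2
  - 2 * sigma * theta * (inner (g k - g k.-1) (x_ k - x)
                         + inner (h k - h k.-1) (y_ k - y))
  + theta * sigma * ((Lxx / alpha + Lyx / gamma) * dx k ^+ 2
                     + (Lxy / beta + Lyy / delta) * dy k ^+ 2).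

Let lyapunov0 : lyapunov 0 = `|x - x_ 0%N| ^+ 2 + `|y - y_ 0%N| ^+ 2.
Proof.
rewrite /lyapunov /dx /dy /= !subrr !normr0 -(scale0r (0 : H1)) innerZl.
by rewrite -(scale0r (0 : H2)) innerZl; ring.
Qed.

Let lyapunov_ge k :
  eta_x * `|x - x_ k| ^+ 2 + eta_y * `|y - y_ k| ^+ 2 <= lyapunov k.
Proof.
have st0 : 0 <= sigma * theta by rewrite mulr_ge0 // ltW.
have nx := ler_wpM2l st0 (extrapolation_x k (x_ k - x)).
have ny := ler_wpM2l st0 (extrapolation_y k (y_ k - y)).
(* After the step terms cancel, the coefficient left on the squared distance exceeds [eta_x] by this
   amount. *)
have cx : 0 <= sigma * (Lxx / alpha + Lyx / gamma) * `|x - x_ k| ^+ 2.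
  by rewrite !mulr_ge0 ?sqr_ge0 ?addr_ge0 ?divr_ge0 ?(Lxx_ge0 hprob)
     ?(Lyx_ge0 hprob) // ltW.
have cy : 0 <= sigma * (Lxy / beta + Lyy / delta) * `|y - y_ k| ^+ 2.
  by rewrite !mulr_ge0 ?sqr_ge0 ?addr_ge0 ?divr_ge0 ?(Lxy_ge0 hprob)
     ?(Lyy_ge0 hprob) // ltW.
move: nx ny cx cy; rewrite /lyapunov /eta_x /eta_y !(distrC _ x) !(distrC _ y).
lra.
Qed.

Let descent k :
  2 * sigma * (real_objective (x_ k.+1) y - real_objective x (y_ k.+1))
    + theta^-1 * lyapunov k.+1 <= lyapunov k.
Proof.
have mu1P : 0 <= mu <= mu1 by rewrite ltW.
have mu2P : 0 <= mu <= mu2 by rewrite ltW.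
have px := prox_step (f1_proper hprob) (f1_lsc hprob) (f1_convex hprob)
  (x_ k) (g k.-1) (g k) (g k.+1) sigma_gt0 mu1P thetaV Dx.
have py := prox_step (f2_proper hprob) (f2_lsc hprob) (f2_convex hprob)
  (y_ k) (h k.-1) (h k) (h k.+1) sigma_gt0 mu2P thetaV Dy.
rewrite -(x_step hiter k) in px.
have yE : y_ k - sigma *: ((1 + theta) *: h k - theta *: h k.-1) =
    y_ k + sigma *: ((1 + theta) *: grad_y Phi (x_ k) (y_ k)
                     - theta *: grad_y Phi (x_ k.-1) (y_ k.-1)).
  by rewrite /h !scalerN -opprD scalerN opprK.
rewrite {}yE -(y_step hiter k) in py.
have gx := convex_gradient_le x (Phi_convex hprob (y_dom k.+1))
  (Phi_diff_x hprob (y_dom k.+1) (x_ k.+1)).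
rewrite -/(grad_x Phi (x_ k.+1) (y_ k.+1)) -/(g k.+1) -opprB innerNr in gx.
have gy := concave_gradient_ge y (Phi_concave hprob (x_dom k.+1))
  (Phi_diff_y hprob (x_dom k.+1) (y_ k.+1)).
rewrite -/(grad_y Phi (x_ k.+1) (y_ k.+1)) -opprB innerNr -innerNl in gy.
rewrite -/(h k.+1) in gy.
(* Here Young's inequality costs a multiple of the new squared step, which the term |p - x0|^2 of
   [prox_step] pays for because [eta_x] is positive. *)
have nx := extrapolation_x k (x_ k - x_ k.+1).
have ny := extrapolation_y k (y_ k - y_ k.+1).
have ex : 0 <= eta_x * dx k.+1 ^+ 2 by rewrite mulr_ge0 ?sqr_ge0 // ltW.
have ey : 0 <= eta_y * dy k.+1 ^+ 2 by rewrite mulr_ge0 ?sqr_ge0 // ltW.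
(* Division by [theta] removes it from the inner products and step terms, matching the error terms
   that [prox_step] leaves at [k.+1]. *)
have -> : theta^-1 * lyapunov k.+1 =
    theta^-1 * (`|x - x_ k.+1| ^+ 2 + `|y - y_ k.+1| ^+ 2)
    - 2 * sigma * (inner (g k.+1 - g k) (x_ k.+1 - x)
                   + inner (h k.+1 - h k) (y_ k.+1 - y))
    + sigma * ((Lxx / alpha + Lyx / gamma) * dx k.+1 ^+ 2
               + (Lxy / beta + Lyy / delta) * dy k.+1 ^+ 2).
  rewrite /lyapunov /=; set a := Lxx / alpha + _; set b := Lxy / beta + _.
  by field; rewrite gt_eqF.
rewrite (distrC (x_ k)) -/(dx k.+1) in nx.
rewrite (distrC (y_ k)) -/(dy k.+1) in ny.
rewrite -/(dx k.+1) in px; rewrite -/(dy k.+1) in py.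
exact: (descent_arith sigma_gt0 theta_gt0 px py gx gy nx ny ex ey).
Qed.

Let ergodic_descent K :
  2 * sigma * \sum_(k < K) (theta ^+ k)^-1 *
      (real_objective (x_ k.+1) y - real_objective x (y_ k.+1))
    + (theta ^+ K)^-1 * lyapunov K
  <= `|x - x_ 0%N| ^+ 2 + `|y - y_ 0%N| ^+ 2.
Proof.
elim: K => [|K IH].
  by rewrite big_ord0 mulr0 add0r expr0 invr1 mul1r lyapunov0.
apply: le_trans IH; rewrite big_ord_recr /= mulrDr -addrA lerD2l.
have c0 : 0 <= (theta ^+ K)^-1 by rewrite invr_ge0 exprn_ge0 // ltW.
by have := ler_wpM2l c0 (descent K); rewrite exprS invfM; lra.
Qed.

Context (t_ : nat -> R).
Hypotheses (t0_gt0 : 0 < t_ 0%N) (t_E : forall k, t_ k = t_ 0%N / theta ^+ k).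

Let t_gt0 k : 0 < t_ k.
Proof. by rewrite t_E divr_gt0 // exprn_gt0. Qed.

Lemma xhat_dom K : dom f1 (weighted_average t_ x_ K.+1).
Proof.
have cF := strongly_convex_on0 (mu1_ge0 hprob)
  (dom_strongly_convex_on (f1_proper hprob) (f1_convex hprob)).
exact: (weighted_average_convex cF t_gt0 x_dom K).1.
Qed.

Lemma yhat_dom K : dom f2 (weighted_average t_ y_ K.+1).
Proof.
have cF := strongly_convex_on0 (mu2_ge0 hprob)
  (dom_strongly_convex_on (f2_proper hprob) (f2_convex hprob)).
exact: (weighted_average_convex cF t_gt0 y_dom K).1.
Qed.

Let gap K := real_objective (weighted_average t_ x_ K.+1) y
             - real_objective x (weighted_average t_ y_ K.+1).

(** Up to constants the gap separates into four convex pieces, [f1], [f2], [Phi] in its first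
    argument and [- Phi] in its second; Jensen applies to each. *)
Let gap_jensen K :
  (\sum_(k < K.+1) t_ k) * gap K <=
  \sum_(k < K.+1) t_ k *
     (real_objective (x_ k.+1) y - real_objective x (y_ k.+1)).
Proof.
have [_ j1] := weighted_average_convex (strongly_convex_on0 (mu1_ge0 hprob)
  (dom_strongly_convex_on (f1_proper hprob) (f1_convex hprob))) t_gt0 x_dom K.
have [_ j2] := weighted_average_convex (strongly_convex_on0 (mu2_ge0 hprob)
  (dom_strongly_convex_on (f2_proper hprob) (f2_convex hprob))) t_gt0 y_dom K.
have [_ j3] := weighted_average_convex
  (convex_function_strongly_convex_on (Phi_convex hprob Dy)) t_gt0
  (fun k => I : setT (x_ k)) K.
have [_ j4] := weighted_average_convex
  (convex_function_strongly_convex_on (Phi_concave hprob Dx)) t_gt0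
  (fun k => I : setT (y_ k)) K.
have := lerD (lerD j1 j2) (lerD j3 j4) => /= {j1 j2 j3 j4}.
rewrite -!big_split /= => j.
rewrite -subr_ge0 in j; rewrite -subr_ge0; apply: le_trans j _.
rewrite le_eqVlt; apply/orP; left; apply/eqP.
rewrite /gap /real_objective.
set a := fine (f1 (weighted_average _ _ _)).
set b := fine (f2 (weighted_average _ _ _)).
set c := fine (Phi (weighted_average _ _ _) _).
set d := fine (Phi _ (weighted_average _ _ _)).
suff -> : \sum_(k < K.+1) t_ k *
     (fine (f1 (x_ k.+1)) + fine (Phi (x_ k.+1) y) - fine (f2 y) -
      (fine (f1 x) + fine (Phi x (y_ k.+1)) - fine (f2 (y_ k.+1)))) =
  \sum_(k < K.+1) (t_ k * fine (f1 (x_ k.+1)) + t_ k * fine (f2 (y_ k.+1)) +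
    (t_ k * fine (Phi (x_ k.+1) y) + t_ k * - fine (Phi x (y_ k.+1))))
  - (\sum_(k < K.+1) t_ k) * (fine (f2 y) + fine (f1 x)) by ring.
by rewrite mulr_suml -sumrB; apply: eq_bigr => k _; ring.
Qed.

(** [T] is the total weight divided by [t_ 0]; bounding it below by its last summand produces the
    rate. *)
Let ergodic_gap K :
  exists2 T, (theta ^+ K)^-1 <= T &
    2 * sigma * (T * gap K) + (theta ^+ K.+1)^-1 *
      (eta_x * `|x - x_ K.+1| ^+ 2 + eta_y * `|y - y_ K.+1| ^+ 2)
    <= `|x - x_ 0%N| ^+ 2 + `|y - y_ 0%N| ^+ 2.
Proof.
exists (\sum_(k < K.+1) (theta ^+ k)^-1).
  rewrite big_ord_recr /= lerDr sumr_ge0 // => k _.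
  by rewrite invr_ge0 exprn_ge0 // ltW.
apply: le_trans (ergodic_descent K.+1); apply: lerD; last first.
  by rewrite ler_wpM2l ?lyapunov_ge // invr_ge0 exprn_ge0 // ltW.
rewrite ler_pM2l ?mulr_gt0 // -(ler_pM2l t0_gt0) mulrA !mulr_sumr.
under eq_bigr do rewrite -t_E.
apply: le_trans (gap_jensen K) _; rewrite le_eqVlt; apply/orP; left; apply/eqP.
by apply: eq_bigr => k _; rewrite mulrA -t_E.
Qed.

Lemma gap_le K :
  real_objective (weighted_average t_ x_ K.+1) y
    - real_objective x (weighted_average t_ y_ K.+1)
  <= theta ^+ K / (2 * sigma) * (`|x - x_ 0%N| ^+ 2 + `|y - y_ 0%N| ^+ 2).
Proof.
rewrite -/(gap K).
have [T hT] := ergodic_gap K; set E := (theta ^+ K.+1)^-1 * _.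
set d := `|x - x_ 0%N| ^+ 2 + _ => hg.
have pK : 0 < theta ^+ K by exact: exprn_gt0.
have d0 : 0 <= d by rewrite addr_ge0 // exprn_ge0.
have s20 : 0 < 2 * sigma by rewrite mulr_gt0.
(* The reference point is arbitrary, so the gap may be negative; the bound is then trivial, and
   otherwise [T] may be replaced by its lower bound. *)
have [g0|g0] := ltP (gap K) 0.
  by apply: le_trans (ltW g0) _; rewrite mulr_ge0 // divr_ge0 // ltW.
have E0 : 0 <= E.
  by rewrite mulr_ge0 ?invr_ge0 ?exprn_ge0 ?addr_ge0 ?mulr_ge0 ?sqr_ge0 // ltW.
rewrite mulrAC ler_pdivlMr // mulrC -ler_pdivrMl //.
have := ler_wpM2l (ltW s20) (ler_wpM2r g0 hT).
lra.
Qed.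

Lemma gap_energy_le K :
  0 <= real_objective (weighted_average t_ x_ K.+1) y
    - real_objective x (weighted_average t_ y_ K.+1) ->
  2 * theta * sigma * (real_objective (weighted_average t_ x_ K.+1) y
    - real_objective x (weighted_average t_ y_ K.+1))
    + (eta_x * `|x - x_ K.+1| ^+ 2 + eta_y * `|y - y_ K.+1| ^+ 2)
  <= theta ^+ K.+1 * (`|x - x_ 0%N| ^+ 2 + `|y - y_ 0%N| ^+ 2).
Proof.
rewrite -/(gap K) => g0.
have [T hT] := ergodic_gap K; set E := eta_x * _ + _.
set d := `|x - x_ 0%N| ^+ 2 + _ => hg.
rewrite -ler_pdivrMl ?exprn_gt0 // mulrDr; apply: le_trans hg; rewrite lerD2r.
have -> : (theta ^+ K.+1)^-1 * (2 * theta * sigma * gap K) =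
    2 * sigma * ((theta ^+ K)^-1 * gap K).
  by rewrite exprS; field; rewrite !gt_eqF // exprn_gt0.
by rewrite ler_pM2l ?mulr_gt0 // ler_wpM2r.
Qed.

(** This supplies the index 0, which [gap_energy_le] does not reach, for linear convergence of the
    iterates. *)
Lemma energy0_le :
  eta_x * `|x - x_ 0%N| ^+ 2 + eta_y * `|y - y_ 0%N| ^+ 2
  <= `|x - x_ 0%N| ^+ 2 + `|y - y_ 0%N| ^+ 2.
Proof. by rewrite -lyapunov0 lyapunov_ge. Qed.

End Descent.

(** * Conclusions at the saddle point *)

Theorem theorem3p14 (R : realType) (H1 H2 : hilbertType R)
  (f1 : H1 -> \bar R) (f2 : H2 -> \bar R) (Phi : H1 -> H2 -> \bar R)
  (mu1 mu2 Lxx Lxy Lyx Lyy : R)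
  (hprob : saddle_problem f1 f2 Phi mu1 mu2 Lxx Lxy Lyx Lyy)
  (mu : R) (mu_def : mu = Num.min mu1 mu2) (mu_gt0 : 0 < mu)
  (f : H1 -> H2 -> \bar R) (f_def : f = objective f1 f2 Phi)
  (xs : H1) (ys : H2) (hsaddle : saddle_point f1 f2 Phi xs ys)
  (tau_ sigma_ lambda_ theta_ : nat -> R) (x_ : nat -> H1) (y_ : nat -> H2)
  (hiter : iterates f1 f2 Phi tau_ sigma_ lambda_ theta_ x_ y_)
  (sigma alpha beta gamma delta : R)
  (sigma_gt0 : 0 < sigma) (alpha_gt0 : 0 < alpha) (beta_gt0 : 0 < beta)
  (gamma_gt0 : 0 < gamma) (delta_gt0 : 0 < delta)
  (theta : R) (theta_def : theta = 1 / (1 + mu * sigma))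
  (tau_E : forall k, tau_ k = sigma) (sigma_E : forall k, sigma_ k = sigma)
  (lambda_E : forall k, lambda_ k = theta)
  (theta_E : forall k, theta_ k = theta)
  (t_ : nat -> R) (t0_gt0 : 0 < t_ 0%N)
  (t_E : forall k, t_ k = t_ 0%N / theta ^+ k)
  (eta_x eta_y : R)
  (eta_x_def : eta_x = 1 - sigma * (1 / (1 + mu * sigma)
                                      * (Lxx * alpha + Lxy * beta)
                                    + Lxx / alpha + Lyx / gamma))
  (eta_x_gt0 : 0 < eta_x)
  (eta_y_def : eta_y = 1 - sigma * (1 / (1 + mu * sigma)
                                      * (Lyx * gamma + Lyy * delta)
                                    + Lxy / beta + Lyy / delta))
  (eta_y_gt0 : 0 < eta_y)
  (xhat : nat -> H1) (xhat_def : xhat = weighted_average t_ x_)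
  (yhat : nat -> H2) (yhat_def : yhat = weighted_average t_ y_) :
  0 < theta < 1 /\
  (* (i) *)
  ((forall K : nat, (0 < K)%N ->
    [/\ (0 <= (2 * theta * sigma)%:E * (f (xhat K) ys - f xs (yhat K))
              + (eta_x * `|xs - x_ K| ^+ 2 + eta_y * `|ys - y_ K| ^+ 2)%:E
           <= (theta ^+ K * (`|xs - x_ 0%N| ^+ 2 + `|ys - y_ 0%N| ^+ 2))%:E)%E,
        (0 <= f (xhat K) ys - f xs (yhat K)
           <= (theta ^+ K.-1 / (2 * sigma)
               * (`|xs - x_ 0%N| ^+ 2 + `|ys - y_ 0%N| ^+ 2))%:E)%E
      & `|xs - x_ K| ^+ 2 + `|ys - y_ K| ^+ 2
        <= theta ^+ K * (1 / Num.min eta_x eta_y)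
           * (`|xs - x_ 0%N| ^+ 2 + `|ys - y_ 0%N| ^+ 2)]) /\
   converges_linearly hilbert_prod_dist 0 (fun k => (x_ k, y_ k)) (xs, ys)) /\
  (* (ii) *)
  ((forall K : nat, (0 < K)%N ->
    ((- (theta ^+ K.-1 / (2 * sigma)
         * (`|xhat K - x_ 0%N| ^+ 2 + `|ys - y_ 0%N| ^+ 2)))%:E
      <= f (xhat K) (yhat K) - f xs ys
      <= (theta ^+ K.-1 / (2 * sigma)
          * (`|xs - x_ 0%N| ^+ 2 + `|yhat K - y_ 0%N| ^+ 2))%:E)%E) /\
   converges_linearly ereal_dist 1 (fun k => f (xhat k) (yhat k)) (f xs ys)).
Proof.
have mus0 : 0 < 1 + mu * sigma by rewrite addr_gt0 // mulr_gt0.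
have thetaV : theta^-1 = 1 + mu * sigma by rewrite theta_def div1r invrK.
have th0 : 0 < theta by rewrite -invr_gt0 thetaV.
have th1 : theta < 1 by rewrite -invf_gt1 // thetaV ltrDl mulr_gt0.
have mu_le1 : mu <= mu1 by rewrite mu_def ge_min lexx.
have mu_le2 : mu <= mu2 by rewrite mu_def ge_min lexx orbT.
rewrite -theta_def in eta_x_def eta_y_def.
have {}hiter : iterates f1 f2 Phi (fun=> sigma) (fun=> sigma) (fun=> theta)
    (fun=> theta) x_ y_.
  by move: hiter; rewrite (funext tau_E) (funext sigma_E) (funext lambda_E)
    (funext theta_E).
have [Dxs Dys] := saddle_point_dom hprob hsaddle.
have Dxh K : dom f1 (xhat K.+1).
  by rewrite xhat_def; exact: (xhat_dom hprob mu_gt0 sigma_gt0 thetaV hiter).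
have Dyh K : dom f2 (yhat K.+1).
  by rewrite yhat_def; exact: (yhat_dom hprob mu_gt0 sigma_gt0 thetaV hiter).
have ex0 := eta_x_gt0; rewrite eta_x_def in ex0.
have ey0 := eta_y_gt0; rewrite eta_y_def in ey0.
pose phi := real_objective f1 f2 Phi.
have fE x y : dom f1 x -> dom f2 y -> f x y = (phi x y)%:E.
  by move=> Dx Dy; rewrite f_def (objectiveE hprob).
have gapP x y K : dom f1 x -> dom f2 y ->
    phi (xhat K.+1) y - phi x (yhat K.+1) <=
    theta ^+ K / (2 * sigma) * (`|x - x_ 0%N| ^+ 2 + `|y - y_ 0%N| ^+ 2).
  move=> Dx Dy; rewrite xhat_def yhat_def.
  exact: (gap_le hprob mu_gt0 mu_le1 mu_le2 sigma_gt0 thetaV hiter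
    alpha_gt0 beta_gt0 gamma_gt0 delta_gt0 ex0 ey0).
have saddle_x x : dom f1 x -> phi xs ys <= phi x ys.
  move=> Dx; have /andP[_] := hsaddle x ys.
  by rewrite -f_def !fE.
have saddle_y y : dom f2 y -> phi xs y <= phi xs ys.
  move=> Dy; have /andP[+ _] := hsaddle xs y.
  by rewrite -f_def !fE.
have gap_ge0 K : 0 <= phi (xhat K.+1) ys - phi xs (yhat K.+1).
  by rewrite subr_ge0 (le_trans (saddle_y _ (Dyh K))) // saddle_x.
have gapE K := gap_energy_le hprob mu_gt0 mu_le1 mu_le2 sigma_gt0 thetaV hiter
  alpha_gt0 beta_gt0 gamma_gt0 delta_gt0 ex0 ey0 Dxs Dys t0_gt0 t_E (K := K).
have gapE0 := energy0_le hprob mu_gt0 sigma_gt0 thetaV hiter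
  alpha_gt0 beta_gt0 gamma_gt0 delta_gt0 xs ys.
rewrite -eta_x_def -eta_y_def in gapE0.
have {}gapE K : 2 * theta * sigma * (phi (xhat K.+1) ys - phi xs (yhat K.+1))
    + (eta_x * `|xs - x_ K.+1| ^+ 2 + eta_y * `|ys - y_ K.+1| ^+ 2)
    <= theta ^+ K.+1 * (`|xs - x_ 0%N| ^+ 2 + `|ys - y_ 0%N| ^+ 2).
  move: (gapE K) (gap_ge0 K); rewrite -eta_x_def -eta_y_def -xhat_def -yhat_def.
  exact.
set d := `|xs - x_ 0%N| ^+ 2 + `|ys - y_ 0%N| ^+ 2 in gapE gapE0 *.
have d0 : 0 <= d by rewrite addr_ge0 // exprn_ge0.
set emin := Num.min eta_x eta_y.
have emin0 : 0 < emin by rewrite lt_min eta_x_gt0.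
have energy_ge K : emin * (`|xs - x_ K| ^+ 2 + `|ys - y_ K| ^+ 2)
    <= eta_x * `|xs - x_ K| ^+ 2 + eta_y * `|ys - y_ K| ^+ 2.
  by rewrite mulrDr lerD // ler_wpM2r ?sqr_ge0 // ge_min lexx ?orbT.
have energy_ge0 K : 0 <= eta_x * `|xs - x_ K| ^+ 2 + eta_y * `|ys - y_ K| ^+ 2.
  by rewrite addr_ge0 // mulr_ge0 ?sqr_ge0 // ltW.
have sqdistP K : `|xs - x_ K| ^+ 2 + `|ys - y_ K| ^+ 2
    <= theta ^+ K * (1 / emin) * d.
  rewrite mul1r mulrAC ler_pdivlMr // mulrC; apply: le_trans (energy_ge K) _.
  case: K => [|K]; first by rewrite expr0 mul1r.
  apply: le_trans (gapE K); rewrite lerDr mulr_ge0 // !mulr_ge0 // ltW //.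
have M0 : 0 <= 1 / emin * d by rewrite mulr_ge0 // divr_ge0 // ltW.
(* Combined with the saddle inequalities, the reference point (xhat, ys) gives the lower bound of
   (ii) and (xs, yhat) the upper one. *)
have hi K := gapP (xhat K.+1) ys K (Dxh K) Dys.
have hs K := gapP xs (yhat K.+1) K Dxs (Dyh K).
split; first by rewrite th0.
split; split.
- case=> // K _; rewrite !fE // -EFinB -EFinM -EFinD !lee_fin; split.
  + rewrite gapE andbT addr_ge0 // mulr_ge0 // !mulr_ge0 // ltW //.
  + by rewrite gap_ge0 gapP.
  + exact: sqdistP.
(* Square roots, since [sqdistP] controls the squared distance. *)
- exists (Num.sqrt (1 / emin * d)), (Num.sqrt theta); split.
  + exact: sqrtr_ge0.
  + by rewrite sqrtr_gt0 th0 -[ltRHS]sqrtr1 ltr_sqrt.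
  + move=> k _; rewrite /hilbert_prod_dist lee_fin /=.
    rewrite -(@ler_pXn2r _ 2) // ?nnegrE ?mulr_ge0 ?exprn_ge0 ?sqrtr_ge0 //.
    rewrite exprMn exprAC !sqr_sqrtr ?addr_ge0 ?exprn_ge0 ?M0 ?(ltW th0) //.
    by rewrite !(distrC _ xs) !(distrC _ ys) mulrC mulrA.
- case=> // K _; rewrite !fE // -EFinB !lee_fin /=.
  have := hi K; have := hs K.
  have := saddle_x _ (Dxh K); have := saddle_y _ (Dyh K).
  by rewrite -!mulrA; move=> *; apply/andP; split; lra.
(* The bounds of (ii) involve the averages themselves; these stay in a fixed ball around the saddle
   point, which yields the uniform constant [B]. *)
- have sqdist_le K : `|xs - x_ K| ^+ 2 + `|ys - y_ K| ^+ 2 <= 1 / emin * d.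
    apply: le_trans (sqdistP K) _; rewrite -mulrA ler_piMl //.
    by rewrite exprn_ile1 // ltW.
  have t_gt0 k : 0 < t_ k by rewrite t_E divr_gt0 // exprn_gt0.
  have xhat_sqdist K : `|xhat K.+1 - xs| ^+ 2 <= 1 / emin * d.
    rewrite xhat_def; apply: weighted_average_sqdist_le t_gt0 _ K => k.
    by rewrite distrC; apply: le_trans (sqdist_le k); rewrite lerDl sqr_ge0.
  have yhat_sqdist K : `|yhat K.+1 - ys| ^+ 2 <= 1 / emin * d.
    rewrite yhat_def; apply: weighted_average_sqdist_le t_gt0 _ K => k.
    by rewrite distrC; apply: le_trans (sqdist_le k); rewrite lerDr sqr_ge0.
  set B := 2 * (1 / emin * d) + 2 * d.
  have B0 : 0 <= B by rewrite /B; lra.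
  (* The extra [theta] in the denominator compensates for the exponent [K] in the bound at index
     [K.+1]. *)
  exists (B / (2 * sigma * theta)), theta; split.
  + by rewrite divr_ge0 // !mulr_ge0 // ltW.
  + by rewrite th0.
  case=> // K _; rewrite !fE // /ereal_dist -EFinB lee_fin /= ler_norml.
  have -> : B / (2 * sigma * theta) * theta ^+ K.+1 =
      theta ^+ K / (2 * sigma) * B.
    by rewrite exprS; field; rewrite !gt_eqF.
  have c0 : 0 <= theta ^+ K / (2 * sigma).
    by rewrite divr_ge0 ?exprn_ge0 ?mulr_ge0 // ltW.
  have Bx : `|xhat K.+1 - x_ 0%N| ^+ 2 + `|ys - y_ 0%N| ^+ 2 <= B.
    have := sqdistD_le (xhat K.+1) xs (x_ 0%N); have := xhat_sqdist K.
    by have := sqr_ge0 `|ys - y_ 0%N|; rewrite /B /d; lra.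
  have By : `|xs - x_ 0%N| ^+ 2 + `|yhat K.+1 - y_ 0%N| ^+ 2 <= B.
    have := sqdistD_le (yhat K.+1) ys (y_ 0%N); have := yhat_sqdist K.
    by have := sqr_ge0 `|xs - x_ 0%N|; rewrite /B /d; lra.
  have := le_trans (hi K) (ler_wpM2l c0 Bx).
  have := le_trans (hs K) (ler_wpM2l c0 By).
  have := saddle_x _ (Dxh K); have := saddle_y _ (Dyh K).
  by move=> *; apply/andP; split; lra.
Qed.
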